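(* Let $k\ge 2$ and $q\ge 1$ be integers, let $\Omega_1,\dots,\Omega_k$ be finite sets with $|\Omega_i|=q$, and let $\mu$ be a pairwise independent probability distribution on $\Omega_1\times\cdots\times\Omega_k$ whose marginals $\mu_i$ satisfy $\mu_i(x)>0$ for all $x\in\Omega_i$. There is a constant $C$ depending only on $\mu$ such that the following holds for every $n$ and every choice of Fourier bases of the spaces $L^2(\Omega_i,\mu_i)$. Let $f_i\in L^2(\Omega_i^n,\mu_i^{\otimes n})$ with $\|f_i\|_2\le 1$ for $i=1,\dots,k$, let $$\delta:=\max_{1\le i\le k-2}\ \max_{\sigma\in\mathbb{Z}_q^n,\ \sigma\ne\mathbf{0}}|\hat f_i(\sigma)|,$$ and let $D:=\deg_{-2}(f_1,\dots,f_k)$ be the sum of the $k-2$ smallest among the Fourier degrees of $f_1,\dots,f_k$. Then $$\left|\langle f_1,\dots,f_k\rangle_\mu-\prod_{i=1}^k\mathbb{E}[f_i]\right|\le\delta\,(k-2)\,C^D .$$ One can take $C=\left(k\sqrt{\tfrac{q-1}{\alpha}}\right)^3$ with $\alpha=\min_i\alpha(\mu_i)$; if all marginals $\mu_i$ are uniform, there is a choice of complex Fourier bases for which one can take $C=(k\sqrt{q-1})^3$.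
   Context: Pairwise independence: for all $i<j$, $a\in\Omega_i$, $b\in\Omega_j$, $\Pr_{x\sim\mu}[x_i=a\wedge x_j=b]=\mu_i(a)\mu_j(b)$, where $\mu_i$ is the marginal of $\mu$ on $\Omega_i$. $\alpha(\mu_i)$ is the minimum non-zero probability of an atom of $\mu_i$. $L^2(\Omega_i^n,\mu_i^{\otimes n})$ is the space of functions $\Omega_i^n\to\mathbb{C}$ with inner product $\langle f,g\rangle=\mathbb{E}[f\overline g]$ and norms $\|f\|_p=(\mathbb{E}|f|^p)^{1/p}$ under the product measure $\mu_i^{\otimes n}$; $\mathbb{E}[f_i]$ is the expectation under $\mu_i^{\otimes n}$. Fourier basis: an orthonormal basis $\chi^i_0,\dots,\chi^i_{q-1}$ of $L^2(\Omega_i,\mu_i)$ with $\chi^i_0\equiv 1$. For $\sigma\in\mathbb{Z}_q^n$ put $\chi^i_\sigma(x_1,\dots,x_n)=\prod_{j=1}^n\chi^i_{\sigma_j}(x_j)$; these form an orthonormal basis of $L^2(\Omega_i^n,\mu_i^{\otimes n})$. The Fourier coefficients of $f\in L^2(\Omega_i^n,\mu_i^{\otimes n})$ are $\hat f(\sigma)=\langle f,\chi^i_\sigma\rangle$. Let $|\sigma|$ be the number of coordinates $j$ with $\sigma_j\ne 0$. The Fourier degree $\deg(f)$ is the infimum of all $d\in\mathbb{Z}$ such that $\hat f(\sigma)=0$ whenever $|\sigma|>d$ (so $\deg(0)=-\infty$; conventions $C^{-\infty}=0$, $0^0=1$, empty sum $=0$, maximum over the empty set $=0$). Noisy inner product: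 $\langle f_1,\dots,f_k\rangle_\mu=\mathbb{E}_X\left[\prod_{i=1}^k f_i(X_i)\right]$, where $X$ is a random $k\times n$ matrix whose $n$ columns are i.i.d. samples from $\mu$, and $X_i\in\Omega_i^n$ is the $i$-th row of $X$. *)

(* Defs.v *)
From mathcomp Require Import all_boot all_order all_algebra.
From mathcomp Require Import all_classical all_reals all_analysis.
From mathcomp Require Export complex.

Set Implicit Arguments.
Unset Strict Implicit.
Unset Printing Implicit Defensive.

Import Order.TTheory GRing.Theory Num.Theory.
Import ComplexField.

Local Open Scope classical_set_scope.
Local Open Scope ring_scope.
Local Open Scope complex_scope.

Section FiniteProbability.
Variables (R : realType) (T : finType).
Implicit Types (w : T -> R) (f g : T -> R[i]).

Definition is_distr w : Prop := (forall x, 0 <= w x) /\ \sum_x w x = 1.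

Definition prob w (A : pred T) : R := \sum_(x | A x) w x.

Definition expect w f : R[i] := \sum_x (w x)%:C * f x.

Definition inner w f g : R[i] := expect w (fun x => f x * (g x)^*).

Definition norm2 w f : R := Num.sqrt (\sum_x w x * Normc.normc (f x) ^+ 2).

(* The neutral element 1 is harmless: it never undercuts an atom of a
   probability distribution, and such a distribution has an atom. *)
Definition min_atom w : R := \big[Num.min/1]_(x | w x != 0) w x.

Definition iid w (n : nat) : {ffun 'I_n -> T} -> R :=
  fun x => \prod_j w (x j).

Definition is_uniform w : Prop := forall x, w x = (#|T|%:R)^-1.

(* Here 'I_q plays the role of Z_q, whose group structure is not used. *)
Definition is_fourier_basis w (q : nat) (chi : 'I_q -> T -> R[i]) : Prop :=
  [/\ forall a : 'I_q, a = 0 :> nat -> forall x, chi a x = 1,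
      forall a b : 'I_q, inner w (chi a) (chi b) = (a == b)%:R
    & forall f, exists c : 'I_q -> R[i],
        forall x, f x = \sum_a c a * chi a x].

End FiniteProbability.

Section Fourier.
Variables (R : realType) (T : finType) (w : T -> R) (q n : nat).
Variable chi : 'I_q -> T -> R[i].
Implicit Types (f : {ffun 'I_n -> T} -> R[i]) (sigma : {ffun 'I_n -> 'I_q}).

Definition chi_prod sigma (x : {ffun 'I_n -> T}) : R[i] :=
  \prod_j chi (sigma j) (x j).

Definition fcoef f sigma : R[i] := inner (@iid R T w n) f (chi_prod sigma).

Definition weight sigma : nat := #|[set j | (sigma j != 0 :> nat)%N]%SET|.

Definition fdeg f : \bar R :=
  ereal_inf [set (d%:~R)%:E | d in [set d : int |
    forall sigma, d < (weight sigma)%:Z -> fcoef f sigma = 0]].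

(* sigma differs from the zero vector iff its weight is positive. *)
Definition max_fcoef f : R :=
  \big[Num.max/0]_(sigma : {ffun 'I_n -> 'I_q} | (0 < weight sigma)%N)
    Normc.normc (fcoef f sigma).

End Fourier.

(* Only used for C >= 0 and D < +oo; note that 0 `^ 0 = 1. *)
Definition pow_ereal (R : realType) (C : R) (D : \bar R) : R :=
  if D is d%:E then C `^ d else 0.

Section NoisyInnerProduct.
Variables (R : realType) (k : nat) (Omega : 'I_k -> finType).
Variable mu : {dffun forall i : 'I_k, Omega i} -> R.

Definition marginal (i : 'I_k) (a : Omega i) : R := prob mu (fun x => x i == a).

Definition pairwise_independent : Prop :=
  forall (i j : 'I_k), (i < j)%N -> forall (a : Omega i) (b : Omega j),
    prob mu (fun x => (x i == a) && (x j == b)) = marginal a * marginal b.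

Definition alpha : R := \big[Num.min/1]_(i < k) min_atom (@marginal i).

Section Functions.
Variables (q n : nat) (chi : forall i : 'I_k, 'I_q -> Omega i -> R[i]).
Variable f : forall i : 'I_k, {ffun 'I_n -> Omega i} -> R[i].

Definition mean (i : 'I_k) : R[i] := expect (@iid _ _ (@marginal i) n) (@f i).

(* X is the random matrix, given as the family of its n columns. *)
Definition noisy_inner : R[i] :=
  expect (@iid _ _ mu n)
    (fun X => \prod_i @f i [ffun j : 'I_n => X j i]).

(* Indices start at 0, so 1 <= i <= k - 2 becomes i < k - 2. *)
Definition delta : R :=
  \big[Num.max/0]_(i < k | (i < k - 2)%N)
    max_fcoef (@marginal i) (@chi i) (@f i).

Definition deg_m2 : \bar R :=
  (\sum_(d <- take (k - 2)
    (sort <=%O [seq fdeg (@marginal i) (@chi i) (@f i) | i <- enum 'I_k])) d)%E.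

End Functions.

Definition low_correlation (q : nat)
    (chi : forall i : 'I_k, 'I_q -> Omega i -> R[i]) (C : R) (n : nat) : Prop :=
  forall f : (forall i : 'I_k, {ffun 'I_n -> Omega i} -> R[i]),
    (forall i, norm2 (@iid _ _ (@marginal i) n) (@f i) <= 1) ->
    Normc.normc (noisy_inner f - \prod_i mean f i)
      <= delta chi f * (k - 2)%:R * pow_ereal C (deg_m2 chi f).

End NoisyInnerProduct.

(* Main.v *)
Require Import Defs.
From mathcomp Require Import all_boot all_order all_algebra.
From mathcomp Require Import cyclic.
From mathcomp Require separable cyclotomic.
From mathcomp Require Import all_classical all_reals all_analysis.
From mathcomp Require Import complex.
From mathcomp Require Import ring lra zify.

(** Write c(a) = E_mu[prod_i chi^i_(a_i)(x_i)] for a in [q]^k. Expanding every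
    f_i in its Fourier basis, <f_1, ..., f_k> - prod_i E[f_i] is the sum, over
    the nonzero k x n arrays s with entries in [q], of prod_j c(column j of s)
    times prod_i fhat_i(row i of s). By pairwise independence c(a) = 0 as soon
    as a has one or two nonzero entries; hence in a nonzero term some row
    i0 < k - 2 is nonzero, and its coefficient is at most delta.

    Let L be the k - 2 indices of smallest degrees. A nonzero term satisfies
    1 <= C^D prod_j C^-|supp(column j) & L|, so it suffices to bound the sum
    of prod_j kap(column j) prod_(i != i0) |fhat_i(row i)| by the product of
    the norms ||f_i||_2, i != i0, where kap(a) = |c(a)| C^-|supp(a) & L|. This
    inequality tensorizes, so only n = 1 matters. There the terms are grouped
    according to P = supp(a): |P| >= 3 gives |P & L| >= |P| - 2, Cauchy-Schwarz
    bounds the group of P by k^-|P| times the largest mass m that some f_i has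
    outside 0, and the sum of k^-|P| over |P| >= 3 is at most 1/2, while the
    term a = 0 is at most 1 - m/2. *)

Set Implicit Arguments.
Unset Strict Implicit.
Unset Printing Implicit Defensive.

Import Order.TTheory GRing.Theory Num.Theory.

Local Open Scope ring_scope.
Local Open Scope complex_scope.

Local Notation normc := Normc.normc.

(* Otherwise [/=] unfolds the conjugation of [R[i]] into [conjc]. *)
#[local] Arguments Num.conj : simpl never.

(** * Arrays and the one-column inequality *)

Section Ffun.
Variables (T : finType) (n : nat).

Definition fcons (a : T) (y : {ffun 'I_n -> T}) : {ffun 'I_n.+1 -> T} :=
  [ffun j => if unlift ord0 j is Some j' then y j' else a].

Lemma fcons0 a y : fcons a y ord0 = a.
Proof. by rewrite ffunE unlift_none. Qed.

Lemma fconsS a y j : fcons a y (lift ord0 j) = y j.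
Proof. by rewrite ffunE liftK. Qed.

Lemma sum_fcons (V : nmodType) (G : {ffun 'I_n.+1 -> T} -> V) :
  \sum_x G x = \sum_a \sum_y G (fcons a y).
Proof.
rewrite pair_big /= (reindex (fun p => fcons p.1 p.2)) //=.
exists (fun x => (x ord0, [ffun j => x (lift ord0 j)])) => [[a y] _|x _] /=.
  by congr pair; [rewrite fcons0|apply/ffunP => j; rewrite ffunE fconsS].
apply/ffunP => j; case: (unliftP ord0 j) => [j'|] ->.
  by rewrite fconsS ffunE.
by rewrite fcons0.
Qed.

End Ffun.

Section Rows.
Variables (I A : finType) (n : nat).

(** Arrays are stored by columns, which is how [mu] and [kap] act on them, whereas Fourier
    coefficients are indexed by rows. *)
Definition frow (s : {ffun 'I_n -> {ffun I -> A}}) (i : I) : {ffun 'I_n -> A} :=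
  [ffun j => s j i].

Lemma sum_frow (V : nmodType) (G : {ffun I -> {ffun 'I_n -> A}} -> V) :
  \sum_t G t = \sum_s G [ffun i => frow s i].
Proof.
rewrite (reindex (fun s => [ffun i => frow s i])) //=.
exists (fun t : {ffun I -> {ffun 'I_n -> A}} =>
    [ffun j => [ffun i => t i j]]) => [s _|t _];
  by do 2![apply/ffunP => ?; rewrite !ffunE].
Qed.

End Rows.

Lemma frow_fcons (I A : finType) n a (s : {ffun 'I_n -> {ffun I -> A}}) i :
  frow (fcons a s) i = fcons (a i) (frow s i).
Proof.
by apply/ffunP => j; rewrite !ffunE; case: unlift => // j'; rewrite ffunE.
Qed.

(* Freezing the first column, the inequality for the other columns turns the
   sum over them into a product of norms of slices, to which the one-column
   inequality applies. *)
Lemma tensor_bound (R : rcfType) (I A : finType) (P : pred I)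
    (kap : {ffun I -> A} -> R) :
    (forall a, 0 <= kap a) ->
    (forall G : I -> A -> R, (forall i b, 0 <= G i b) ->
      \sum_a kap a * \prod_(i | P i) G i (a i)
        <= \prod_(i | P i) Num.sqrt (\sum_b G i b ^+ 2)) ->
  forall n (F : I -> {ffun 'I_n -> A} -> R), (forall i x, 0 <= F i x) ->
    \sum_(s : {ffun 'I_n -> {ffun I -> A}})
        (\prod_j kap (s j)) * \prod_(i | P i) F i (frow s i)
      <= \prod_(i | P i) Num.sqrt (\sum_x F i x ^+ 2).
Proof.
move=> kap0 col; elim=> [|n IHn] F F0.
  pose e T : {ffun 'I_0 -> T} := ffun0 (card_ord 0).
  have eE T (x : {ffun 'I_0 -> T}) : x = e T by apply/ffunP => -[].
  have sum0 (T : finType) (G : {ffun 'I_0 -> T} -> R) : \sum_x G x = G (e T).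
    rewrite (bigD1 (e T)) //= big1 ?addr0 // => x; by rewrite (eE _ x) eqxx.
  rewrite sum0 big_ord0 mul1r; apply: ler_prod => i _.
  by rewrite F0 sum0 sqrtr_sqr /= (eE _ (frow _ _)) ler_norm.
rewrite sum_fcons.
pose G i b := Num.sqrt (\sum_x F i (fcons b x) ^+ 2).
have -> : \prod_(i | P i) Num.sqrt (\sum_x F i x ^+ 2) =
          \prod_(i | P i) Num.sqrt (\sum_b G i b ^+ 2).
  apply: eq_bigr => i _; rewrite sum_fcons; congr Num.sqrt; apply: eq_bigr => b _.
  by rewrite sqr_sqrtr // sumr_ge0 // => x _; rewrite sqr_ge0.
apply: le_trans (col G _); last by move=> i b; exact: sqrtr_ge0.
apply: ler_sum => a _.
have := IHn (fun i x => F i (fcons (a i) x)) (fun i x => F0 _ _).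
move/(ler_wpM2l (kap0 a)); apply: le_trans; rewrite mulr_sumr le_eqVlt.
apply/orP; left; apply/eqP; apply: eq_bigr => s _.
rewrite big_ord_recl fcons0 mulrA; congr (_ * _ * _).
  by apply: eq_bigr => j _; rewrite fconsS.
by apply: eq_bigr => i _; rewrite frow_fcons.
Qed.

(** Lagrange's identity: twice the difference of the two sides is the sum of the squares of
    [x i * y j - x j * y i]. *)
Lemma sum_cauchy_schwarz (R : realFieldType) (I : finType) (P : pred I)
    (x y : I -> R) :
  (\sum_(i | P i) x i * y i) ^+ 2 <=
  (\sum_(i | P i) x i ^+ 2) * (\sum_(i | P i) y i ^+ 2).
Proof.
rewrite -subr_ge0 -(pmulr_rge0 _ (ltr0n R 2)).
have -> : 2 * ((\sum_(i | P i) x i ^+ 2) * (\sum_(i | P i) y i ^+ 2)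
          - (\sum_(i | P i) x i * y i) ^+ 2) =
   \sum_(i | P i) \sum_(j | P j) (x i * y j - x j * y i) ^+ 2.
  have E i j : (x i * y j - x j * y i) ^+ 2 =
     (x i ^+ 2 * y j ^+ 2 + y i ^+ 2 * x j ^+ 2)
        - 2 * ((x i * y i) * (x j * y j)) by ring.
  rewrite [RHS](eq_bigr (fun i => x i ^+ 2 * (\sum_(j | P j) y j ^+ 2)
     + y i ^+ 2 * (\sum_(j | P j) x j ^+ 2)
     - 2 * ((x i * y i) * \sum_(j | P j) x j * y j))); last first.
    move=> i _; under eq_bigr do rewrite E; rewrite sumrB big_split /=.
    by rewrite -!mulr_sumr.
  rewrite sumrB big_split /= -!mulr_suml -!mulr_sumr -mulr_suml; ring.
by apply: sumr_ge0 => i _; apply: sumr_ge0 => j _; exact: sqr_ge0.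
Qed.

Lemma fact_ge_exp2 r : (2 ^ r.-1 <= r`!)%N.
Proof.
elim: r => // -[|r] IHr //; rewrite factS expnS.
by apply: leq_mul.
Qed.

Lemma ffact_le_exp m r : (m ^_ r <= m ^ r)%N.
Proof.
elim: r => // r IHr; rewrite ffactnSr expnSr.
by rewrite leq_mul // leq_subr.
Qed.

(** Write k for [#|I|]. At most k^r / r! sets have size r, and r! >= 2^(r-1), so these sets
    contribute at most 2 * 2^-r; the tail of this series from r = 3 on is 1/2. *)
Lemma sum_card_ge3 (R : realFieldType) (I : finType) : (2 <= #|I|)%N ->
  \sum_(P : {set I} | (3 <= #|P|)%N) (#|I|%:R : R) ^- #|P| <= 2^-1.
Proof.
move=> k2; have k0 : (0 : R) < #|I|%:R by rewrite ltr0n (leq_trans _ k2).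
pose h := (2^-1 : R).
have cardB (P : {set I}) : (#|P| < #|I|.+1)%N by rewrite ltnS max_card.
rewrite (partition_big (fun P => Ordinal (cardB P)) (fun r => 3 <= r)%N) //=.
apply: (@le_trans _ _ (\sum_(r < #|I|.+1 | (3 <= r)%N) 2 * h ^+ r)).
  apply: ler_sum => r r3.
  rewrite (eq_bigr (fun=> (#|I|%:R : R) ^- r)); last first.
    by move=> P /andP[_ /eqP <-].
  have -> : \sum_(P : {set I} | (2 < #|P|)%N && (Ordinal (cardB P) == r))
     (#|I|%:R : R) ^- r = 'C(#|I|, r)%:R * #|I|%:R ^- r.
    rewrite sumr_const -card_draws -[LHS]mulr_natl cardsE; congr (_ * _).
    congr (_%:R); apply: eq_card => P.
    change ((2 < #|P|)%N && (#|P| == r) = (#|P| == r)).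
    by case: eqP => [->|]; rewrite ?r3 ?andbF.
  rewrite ler_pdivrMr ?exprn_gt0 //.
  have r1 : (0 < r)%N by apply: leq_trans r3.
  have -> : 2 * h ^+ r = (2 ^ r.-1)%:R^-1.
    by rewrite -(prednK r1) /= exprS mulrA divff ?pnatr_eq0 // mul1r natrX exprVn.
  rewrite mulrC ler_pdivlMr ?ltr0n ?expn_gt0 // -natrX -natrM ler_nat.
  apply: (@leq_trans ('C(#|I|, r) * r`!)%N); first by rewrite leq_mul2l fact_ge_exp2 orbT.
  by rewrite bin_ffact ffact_le_exp.
rewrite -mulr_sumr.
(* [K] stands for [#|I| - 2], so the range is [r <= #|I|]. *)
have geo K : \sum_(r < K.+3 | (3 <= r)%N) h ^+ r = 4^-1 - h ^+ K.+2.
  elim: K => [|K IHK].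
    by rewrite big1 => [|[[|[|[|]]]]] //; rewrite /h; field.
  rewrite big_mkcond big_ord_recr /= -big_mkcond IHK /h [_ ^+ K.+3]exprS; field.
  by rewrite ?expf_neq0 ?pnatr_eq0.
case: {cardB} #|I| k2 => [|[|K]] // _; rewrite geo.
have : 0 <= h ^+ K.+2 by rewrite exprn_ge0 // invr_ge0 ler0n.
move: (h ^+ _) => t t0; lra.
Qed.

Section Support.
Variables (I A : finType) (z : A).

Definition fsupp (a : {ffun I -> A}) : {set I} := [set i | a i != z].

(** Once the support is prescribed, the entries vary independently: over the symbols other than [z]
    at positions in [P], over [z] alone elsewhere. The equality of booleans covers both cases. *)
Lemma sum_fsupp_prod (S : pzSemiRingType) (P : {set I}) (h : I -> A -> S) :
  \sum_(a | fsupp a == P) \prod_i h i (a i) =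
  \prod_i \sum_(b | (b != z) == (i \in P)) h i b.
Proof.
rewrite (big_distr_big_dep z) /=; apply: eq_bigl => a.
apply/eqP/pfamilyP => [<-|[_ aP]].
  split=> [|i _]; first exact/fintype.subsetP.
  by rewrite inE; exact: eqxx.
by apply/finset.setP => i; rewrite inE; have /eqP := aP i isT.
Qed.

End Support.

(** * The inequality for a single column *)

Section Column.
Variables (R : rcfType) (I A : finType) (z : A) (i0 : I) (L : {set I}) (B : R).
Variable c : {ffun I -> A} -> R.

Hypothesis I2 : (2 <= #|I|)%N.
Hypothesis cardL : #|L| = (#|I| - 2)%N.
Hypothesis B1 : 1 <= B.
Hypothesis cardA : #|A|%:R - 1 <= B ^+ 2.
Hypothesis c_ge0 : forall a, 0 <= c a.
Hypothesis c_supp0 : forall a, fsupp z a = finset.set0 -> c a <= 1.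
Hypothesis c_supp12 : forall a, (0 < #|fsupp z a| < 3)%N -> c a = 0.
Hypothesis c_supp3 : forall P : {set I}, (3 <= #|P|)%N ->
  \sum_(a | fsupp z a == P) c a ^+ 2 <= B ^+ (#|P|.-1).*2.

(** The constant called C in the overview, not the degree called D there. *)
Let D : R := (#|I|%:R * B) ^+ 3.

Section Normalized.
Variable H : I -> A -> R.
Hypothesis H_ge0 : forall i b, 0 <= H i b.
Hypothesis H_le1 : forall i, \sum_b H i b ^+ 2 <= 1.

Let E i := \sum_(b | b != z) H i b ^+ 2.

Let E_ge0 i : 0 <= E i.
Proof. by apply: sumr_ge0 => b _; exact: sqr_ge0. Qed.

Let HzE i : H i z ^+ 2 + E i <= 1.
Proof. by apply: le_trans (H_le1 i); rewrite [leRHS](bigD1 z). Qed.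

Let x := #|I|%:R * B.

Let card_ge1 : 1 <= (#|I|%:R : R).
Proof. by rewrite ler1n (leq_trans _ I2). Qed.

Let x_ge1 : 1 <= x.
Proof. by rewrite -[1]mulr1 ler_pM. Qed.

(** The sum factors over the rows. Row [i0] is missing from the product and only counts symbols, at
    most [B ^+ 2] of them; each other row of [P] gives at most [m], and the remaining rows at most
    1. *)
Lemma sqr_column_block_le (m : R) (P : {set I}) : (3 <= #|P|)%N ->
    (forall i, i != i0 -> E i <= m) -> 0 <= m <= 1 ->
  \sum_(a | fsupp z a == P) (\prod_(i | i != i0) H i (a i)) ^+ 2
     <= (B * m) ^+ 2.
Proof.
move=> P3 Em /andP[m0 m1].
have -> : \sum_(a | fsupp z a == P) (\prod_(i | i != i0) H i (a i)) ^+ 2 =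
   \sum_(a | fsupp z a == P) \prod_i (if i != i0 then H i (a i) ^+ 2 else 1).
  by apply: eq_bigr => a _; rewrite -big_mkcond /= prodrXl.
rewrite (sum_fsupp_prod z P (fun i b => if i != i0 then H i b ^+ 2 else 1)).
pose u i := if i == i0 then B ^+ 2 else if i \in P then m else 1.
apply: (@le_trans _ _ (\prod_i u i)).
  apply: ler_prod => i _; apply/andP; split.
    by apply: sumr_ge0 => b _; case: ifP => // _; exact: sqr_ge0.
  rewrite /u; have [_|ii0] /= := eqVneq i i0; last first.
    case: (i \in P).
      by rewrite (eq_bigl (fun b => b != z)) ?Em // => b; rewrite eqb_id.
    rewrite (eq_bigl (pred1 z)) => [|b]; last by rewrite eqbF_neg negbK.
    by rewrite big_pred1_eq; apply: le_trans (HzE i); rewrite lerDl.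
  rewrite sumr_const; case: (i \in P).
    rewrite (@eq_card _ _ (predC1 z)) => [|b]; last exact: eqb_id.
    apply: le_trans cardA; rewrite lerBrDr -mulrSr ler_nat.
    by rewrite -(cardC (pred1 z)) card1.
  rewrite (@eq_card _ _ (pred1 z)) => [|b]; last first.
    by apply: etrans (eqbF_neg _) _; rewrite negbK.
  by rewrite card1 mulr1n exprn_ege1.
rewrite (bigD1 i0) //= {1}/u eqxx exprMn ler_wpM2l ?sqr_ge0 //.
rewrite (eq_bigr (fun i => if i \in P then m else 1)); last first.
  by move=> i /negPf ii0; rewrite /u ii0.
rewrite -big_mkcondr /= prodr_const.
rewrite (@eq_card _ _ (P :\ i0)) => [|i]; last by rewrite !inE.
(* At least two factors [m] survive the removal of [i0]; any further ones are dropped since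
   [m <= 1]. *)
have: (1 < #|P :\ i0|)%N.
  by have := cardsD1 i0 P; case: (i0 \in P) => /=; move: P3; lia.
move=> P2; rewrite -(subnKC P2) exprD ler_piMr ?sqr_ge0 //.
exact: exprn_ile1.
Qed.

(** Cauchy-Schwarz, with [c_supp3] for one factor, gives B^p m where p = [#|P|]. As [L] omits two
    rows, it contains at least p - 2 elements of [P], and 3 (p - 2) >= p: the cube in [D] thus
    yields a factor (k B)^-p. *)
Lemma column_block_le (m : R) (P : {set I}) : (3 <= #|P|)%N ->
    (forall i, i != i0 -> E i <= m) -> 0 <= m <= 1 ->
  \sum_(a | fsupp z a == P)
      c a * D ^- #|P :&: L| * \prod_(i | i != i0) H i (a i)
    <= #|I|%:R ^- #|P| * m.
Proof.
move=> P3 Em m01; have m0 : 0 <= m by case/andP: m01.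
have x0 : 0 < x := lt_le_trans ltr01 x_ge1.
have B0 : 0 < B := lt_le_trans ltr01 B1.
have k0 : 0 < #|I|%:R :> R := lt_le_trans ltr01 card_ge1.
have S0 : \sum_(a | fsupp z a == P) c a * \prod_(i | i != i0) H i (a i)
    <= B ^+ #|P| * m.
  rewrite -ler_sqr ?nnegrE; last first.
  - by rewrite mulr_ge0 // exprn_ge0 // ltW.
  - by apply: sumr_ge0 => a _; rewrite mulr_ge0 // prodr_ge0.
  apply: le_trans (sum_cauchy_schwarz _ _ _) _.
  apply: (@le_trans _ _ (B ^+ (#|P|.-1).*2 * (B * m) ^+ 2)).
    rewrite ler_pM ?c_supp3 ?sqr_column_block_le //;
      by apply: sumr_ge0 => a _; exact: sqr_ge0.
  rewrite -muln2 exprM -exprMn mulrA -exprSr prednK //.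
  by apply: leq_trans P3.
rewrite (eq_bigr (fun a => D ^- #|P :&: L| *
   (c a * \prod_(i | i != i0) H i (a i)))); last by move=> a _; ring.
rewrite -mulr_sumr.
apply: (@le_trans _ _ (x ^- #|P| * (B ^+ #|P| * m))).
  apply: ler_pM => //.
  - by rewrite invr_ge0 exprn_ge0 // exprn_ge0 // ltW.
  - by apply: sumr_ge0 => a _; rewrite mulr_ge0 // prodr_ge0.
  rewrite lef_pV2 ?posrE ?exprn_gt0 // -/x -exprM ler_weXn2l //.
  have := cardsID L P; have := cardsID P L; rewrite cardL.
  have : (#|P :\: L| <= #|~: L|)%N.
    by apply: subset_leq_card; apply/fintype.subsetP => i; rewrite !inE => /andP[].
  by have := cardsC L; rewrite cardL; move: P3 I2; lia.
rewrite /x exprMn invfM mulrA -[X in X * m]mulrA mulVf ?mulr1 //.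
by rewrite expf_neq0 // gt_eqF.
Qed.

Lemma column_bound_normalized :
  \sum_a c a * D ^- #|fsupp z a :&: L| * \prod_(i | i != i0) H i (a i) <= 1.
Proof.
(* [j] is a row of largest mass outside [z] among those other than [i0], which exist because there
   are at least two rows. *)
have [j ji0 jmax] : exists2 j, j != i0 & forall i, i != i0 -> E i <= E j.
  have /card_gt0P[i1] : (0 < #|predC1 i0|)%N.
    by have := cardC1 i0; move: I2; lia.
  rewrite inE => i10; exists [arg max_(j > i1 | j != i0) E j]%O.
    by case: Order.TotalTheory.arg_maxP.
  by case: Order.TotalTheory.arg_maxP.
set m := E j; have m0 : 0 <= m := E_ge0 j.
have m1 : m <= 1 by apply: le_trans (HzE j); rewrite lerDr sqr_ge0.
rewrite (partition_big (fsupp z) predT) //=.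
rewrite (eq_bigr (fun P => \sum_(a | fsupp z a == P)
   c a * D ^- #|P :&: L| * \prod_(i | i != i0) H i (a i))); last first.
  by move=> P _; apply: eq_bigr => a /eqP ->.
rewrite (bigD1 finset.set0) //= (bigID (fun P : {set I} => (3 <= #|P|)%N)) /=.
rewrite [X in _ + (_ + X)]big1 ?addr0; last first.
  move=> P /andP[P0 P3]; apply: big1 => a /eqP aP.
  by rewrite c_supp12 ?mul0r // aP card_gt0 P0 ltnNge.
have T0 : \sum_(a | fsupp z a == finset.set0)
    c a * D ^- #|finset.set0 :&: L| * \prod_(i | i != i0) H i (a i) <= 1 - m / 2.
  rewrite (big_pred1 [ffun=> z]) => [|a]; last first.
    apply/eqP/eqP => [a0|->]; last by apply/finset.setP => i; rewrite !inE ffunE eqxx.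
    apply/ffunP => i; rewrite ffunE; apply/eqP; move/finset.setP/(_ i): a0.
    by rewrite !inE => /negbFE.
  rewrite finset.set0I cards0 expr0 invr1 mulr1.
  have Hz1 i : 0 <= H i z <= 1.
    rewrite H_ge0 /= -(@expr_le1 _ 2) //; apply: le_trans (HzE i).
    by rewrite lerDl.
  apply: (@le_trans _ _ (1 * H j z)).
    apply: ler_pM => //; first by apply: prodr_ge0.
      by apply: c_supp0; apply/finset.setP => i; rewrite !inE ffunE eqxx.
    rewrite (bigD1 j) //= ffunE -[leRHS]mulr1 ler_wpM2l //.
    by apply: prodr_ile1 => i _; rewrite ffunE.
  rewrite mul1r -ler_sqr ?nnegrE //; last by move: m1; lra.
  (* Here [H j z ^+ 2 <= 1 - m <= (1 - m / 2) ^+ 2]. *)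
  have := HzE j; rewrite -/m; have := sqr_ge0 m; move: m0 m1.
  by move: (H j z) => t; nra.
have T3 : \sum_(P : {set I} | (P != finset.set0) && (2 < #|P|)%N)
    \sum_(a | fsupp z a == P)
       c a * D ^- #|P :&: L| * \prod_(i | i != i0) H i (a i) <= m / 2.
  rewrite (eq_bigl (fun P : {set I} => 2 < #|P|)%N); last first.
    by move=> P; case: eqVneq => //= ->; rewrite cards0.
  apply: (@le_trans _ _
     (\sum_(P : {set I} | (2 < #|P|)%N) #|I|%:R ^- #|P| * m)).
    by apply: ler_sum => P P3; apply: column_block_le; rewrite ?m0.
  by rewrite -mulr_suml mulrC ler_wpM2l // sum_card_ge3.
move: T0 T3; lra.
Qed.

End Normalized.

(** Both sides are homogeneous in each row, so the rows can be divided by their norms. *)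
Lemma column_bound (G : I -> A -> R) : (forall i b, 0 <= G i b) ->
  \sum_a c a * D ^- #|fsupp z a :&: L| * \prod_(i | i != i0) G i (a i)
    <= \prod_(i | i != i0) Num.sqrt (\sum_b G i b ^+ 2).
Proof.
move=> G0; pose N i := Num.sqrt (\sum_b G i b ^+ 2).
have N0 i : 0 <= N i by exact: sqrtr_ge0.
have NE i : N i ^+ 2 = \sum_b G i b ^+ 2.
  by rewrite sqr_sqrtr // sumr_ge0 // => b _; exact: sqr_ge0.
pose H i b := G i b / N i.
have GE i b : G i b = N i * H i b.
  (* A row of norm 0 vanishes identically. *)
  have [Ni0|Ni0] := eqVneq (N i) 0; last by rewrite /H mulrC divfK.
  rewrite Ni0 mul0r; apply/eqP; rewrite -sqrf_eq0 eq_le sqr_ge0 andbT.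
  have -> : 0 = \sum_b G i b ^+ 2 by rewrite -NE Ni0 expr0n.
  by rewrite (bigD1 b) //= lerDl sumr_ge0 // => b' _; exact: sqr_ge0.
have H1 i : \sum_b H i b ^+ 2 <= 1.
  under eq_bigr do rewrite expr_div_n.
  rewrite -mulr_suml -NE; have [->|Ni0] := eqVneq (N i) 0.
    by rewrite expr0n mul0r.
  by rewrite divff // expf_neq0.
rewrite (eq_bigr (fun a => (\prod_(i | i != i0) N i) *
    (c a * D ^- #|fsupp z a :&: L| * \prod_(i | i != i0) H i (a i)))); last first.
  move=> a _; rewrite (eq_bigr _ (fun i _ => GE i (a i))) big_split /=; ring.
rewrite -mulr_sumr ler_piMr ?prodr_ge0 // column_bound_normalized // => i b.
by rewrite divr_ge0.
Qed.

End Column.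

(** * Fourier analysis *)

Section ComplexNorm.
Variable R : realType.
Implicit Types z : R[i].

Lemma normc_ge0 z : 0 <= normc z.
Proof. by case: z => a b; exact: sqrtr_ge0. Qed.

Lemma sqr_normcE z : (normc z ^+ 2)%:C = z * z^*%R.
Proof. by rewrite rmorphXn /= -normCK. Qed.

Lemma normc_sum (I : finType) (P : pred I) (F : I -> R[i]) :
  normc (\sum_(i | P i) F i) <= \sum_(i | P i) normc (F i).
Proof.
elim/big_rec2: _ => [|i y x _ yx]; first by rewrite Normc.normc0.
by apply: le_trans (le_normcD _ _) _; rewrite lerD2l.
Qed.

Lemma normc_prod (I : finType) (P : pred I) (F : I -> R[i]) :
  normc (\prod_(i | P i) F i) = \prod_(i | P i) normc (F i).
Proof. exact: (big_morph _ (@Normc.normcM R) (@Normc.normc1 R)). Qed.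

Lemma normc_real (r : R) : 0 <= r -> normc r%:C = r.
Proof. by move=> r0; rewrite /= expr0n /= addr0 sqrtr_sqr ger0_norm. Qed.

Lemma conj_creal (r : R) : (r%:C)^*%R = r%:C :> R[i].
Proof. exact: conjc_real. Qed.

Lemma conj_mul z z' : (z * z')^*%R = z^*%R * z'^*%R :> R[i].
Proof. exact: rmorphM. Qed.

Lemma conj_sum (I : finType) (P : pred I) (F : I -> R[i]) :
  (\sum_(i | P i) F i)^*%R = \sum_(i | P i) ((F i)^*%R : R[i]).
Proof. exact: rmorph_sum. Qed.

Lemma conj_prod (I : finType) (P : pred I) (F : I -> R[i]) :
  (\prod_(i | P i) F i)^*%R = \prod_(i | P i) ((F i)^*%R : R[i]).
Proof. exact: rmorph_prod. Qed.

Lemma creal_mul (r r' : R) : (r * r')%:C = r%:C * r'%:C.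
Proof. exact: rmorphM. Qed.

Lemma creal_sum (I : finType) (P : pred I) (F : I -> R) :
  (\sum_(i | P i) F i)%:C = \sum_(i | P i) (F i)%:C.
Proof. exact: rmorph_sum. Qed.

Lemma creal_prod (I : finType) (P : pred I) (F : I -> R) :
  (\prod_(i | P i) F i)%:C = \prod_(i | P i) (F i)%:C.
Proof. exact: rmorph_prod. Qed.

Lemma normc_conj z : normc z^*%R = normc z.
Proof. by case: z => a b /=; rewrite sqrrN. Qed.

End ComplexNorm.

Lemma card_ord_neq0 q : #|fun a : 'I_q => a != 0%N :> nat| = (q - 1)%N.
Proof.
case: q => [|q]; first by apply: eq_card0 => -[].
rewrite subn1 -[in RHS](card_ord q.+1) -(cardC1 ord0).
by apply: eq_card => a; rewrite inE -val_eqE.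
Qed.

Section Fourier.
Variables (R : realType) (T : finType) (w : T -> R) (q : nat).
Variable chi : 'I_q -> T -> R[i].
Hypothesis chiP : is_fourier_basis w chi.

Lemma inner_combination (c : 'I_q -> R[i]) f b :
  (forall x, f x = \sum_a c a * chi a x) -> inner w f (chi b) = c b.
Proof.
case: chiP => _ orth _ fE; rewrite /inner /expect.
under eq_bigr do rewrite fE mulr_suml mulr_sumr.
rewrite exchange_big /= (eq_bigr (fun a => c a * inner w (chi a) (chi b))).
  rewrite (bigD1 b) //= orth eqxx mulr1 big1 ?addr0 // => a /negPf ab.
  by rewrite orth ab mulr0.
by move=> a _; rewrite mulr_sumr; apply: eq_bigr => x _; ring.
Qed.

(** The completeness relation: this is the expansion at [x] of the indicator function of [y]. *)
Lemma basis_kernel x y :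
  (w y)%:C * \sum_a chi a x * (chi a y)^* = (x == y)%:R.
Proof.
have [_ _ /(_ (fun x => (x == y)%:R))[c cE]] := chiP.
rewrite cE mulr_sumr; apply: eq_bigr => a _.
rewrite -(inner_combination a cE) /inner /expect (bigD1 y) //= eqxx mul1r.
rewrite big1 ?addr0 => [|x' /negPf ->]; first by ring.
by rewrite mul0r mulr0.
Qed.

(** The diagonal of the completeness relation. It bounds the basis at a point by the inverse of the
    atom there, which is how [alpha] enters the constant. *)
Lemma sum_sqr_basis x : w x * \sum_a normc (chi a x) ^+ 2 = 1.
Proof.
apply: (@complexI R); rewrite creal_mul creal_sum.
under eq_bigr do rewrite sqr_normcE.
by rewrite basis_kernel eqxx.
Qed.

Variable n : nat.
Implicit Type f : {ffun 'I_n -> T} -> R[i].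

Lemma fourier_expansion f x :
  f x = \sum_sigma fcoef w chi f sigma * chi_prod chi sigma x.
Proof.
rewrite /fcoef /inner /expect.
under eq_bigr do rewrite mulr_suml.
rewrite exchange_big /= (bigD1 x) //=.
(* The sum over [sigma] becomes a product over coordinates of weighted kernels, each a Kronecker
   delta by [basis_kernel]. *)
have E y : \sum_(sigma : {ffun 'I_n -> 'I_q})
    (iid w y)%:C * (f y * (chi_prod chi sigma y)^*) * chi_prod chi sigma x
    = f y * (x == y)%:R.
  transitivity (f y * ((\prod_j (w (y j))%:C) *
    \prod_j \sum_a chi a (x j) * (chi a (y j))^*)).
    rewrite (bigA_distr_bigA (fun j a => chi a (x j) * (chi a (y j))^*)) /=.
    rewrite !mulr_sumr; apply: eq_bigr => s _; rewrite big_split /= /iid.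
    by rewrite creal_prod /chi_prod conj_prod; ring.
  congr (_ * _); rewrite -big_split /=.
  under eq_bigr do rewrite basis_kernel.
  have [->|xy] := eqVneq x y; first by apply: big1 => j _; rewrite eqxx.
  have [j xyj] : exists j, x j != y j.
    by apply/existsP; apply: contraNT xy => /existsPn xy; apply/eqP/ffunP => j;
       apply/eqP; rewrite -[_ == _]negbK xy.
  by rewrite (bigD1 j) //= (negPf xyj) mul0r.
rewrite E eqxx mulr1 big1 ?addr0 // => y; rewrite eq_sym => /negPf xy.
by rewrite E xy mulr0.
Qed.

Lemma parseval f :
  \sum_sigma normc (fcoef w chi f sigma) ^+ 2
    = \sum_x iid w x * normc (f x) ^+ 2.
Proof.
apply: (@complexI R); rewrite !creal_sum.
under eq_bigr do rewrite sqr_normcE {2}/fcoef /inner /expect conj_sum mulr_sumr.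
rewrite exchange_big /=; apply: eq_bigr => x _.
rewrite creal_mul sqr_normcE [X in _ = _ * (X * _)]fourier_expansion mulr_suml mulr_sumr.
apply: eq_bigr => s _; rewrite !conj_mul.
by rewrite conj_creal conjCK; ring.
Qed.

Lemma fcoef_eq0 f : (forall sigma, fcoef w chi f sigma = 0) ->
  forall x, f x = 0.
Proof.
move=> f0 x; rewrite fourier_expansion big1 // => s _.
by rewrite f0 mul0r.
Qed.

Lemma fcoef_weight0 f sigma : weight sigma = 0%N ->
  fcoef w chi f sigma = expect (iid w (n := n)) f.
Proof.
move=> s0; apply: eq_bigr => x _; congr (_ * _); rewrite /chi_prod.
rewrite big1 ?conjC1 ?mulr1 // => j _; case: chiP => chi0 _ _; apply: chi0.
apply/eqP; move/eqP: s0; rewrite cards_eq0 => /eqP/setP/(_ j).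
by rewrite !inE => /negbFE.
Qed.

Lemma expect_basis (a : 'I_q) : a != 0 :> nat -> expect w (chi a) = 0.
Proof.
move=> a0; have q0 : (0 < q)%N by apply: leq_ltn_trans (ltn_ord a).
case: chiP => chi0 orth _; have : inner w (chi a) (chi (Ordinal q0)) = 0.
  by rewrite orth -val_eqE /= (negPf a0).
move=> <-; apply: eq_bigr => x _.
by rewrite (chi0 (Ordinal q0)) // conjC1 mulr1.
Qed.

(** The kernel of the orthogonal projection onto the functions of mean zero. *)
Let K x y := \sum_(a : 'I_q | a != 0 :> nat) chi a x * (chi a y)^*.

(** The squared Hilbert-Schmidt norm of a projection is its rank. Expanded, it is the sum of
    |<chi_a, chi_b>|^2 over nonzero [a] and [b]. *)
Lemma sum_sqr_kernel : (0 < q)%N ->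
  \sum_x \sum_y w x * w y * normc (K x y) ^+ 2 = q%:R - 1.
Proof.
move=> q0; apply: (@complexI R); have [_ orth _] := chiP.
pose nz (a : 'I_q) := a != 0%N :> nat.
transitivity (\sum_(a | nz a) \sum_(b | nz b)
   inner w (chi a) (chi b) * (inner w (chi a) (chi b))^*).
  rewrite creal_sum.
  transitivity (\sum_x \sum_y \sum_(a | nz a) \sum_(b | nz b)
    ((w x)%:C * (chi a x * (chi b x)^*)) *
    ((w y)%:C * (chi a y * (chi b y)^*))^*).
    apply: eq_bigr => x _; rewrite creal_sum; apply: eq_bigr => y _.
    rewrite creal_mul sqr_normcE creal_mul /K conj_sum mulr_suml mulr_sumr.
    apply: eq_bigr => a _; rewrite !mulr_sumr; apply: eq_bigr => b _.
    rewrite !conj_mul.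
    by rewrite conj_creal !conjCK; ring.
  rewrite /inner /expect.
  under eq_bigr do rewrite exchange_big /=.
  rewrite exchange_big /=; apply: eq_bigr => a _.
  under eq_bigr do rewrite exchange_big /=.
  rewrite exchange_big /=; apply: eq_bigr => b _.
  by rewrite conj_sum mulr_suml; apply: eq_bigr => x _; rewrite mulr_sumr.
rewrite (eq_bigr (fun=> 1)) => [|a a0]; last first.
  rewrite (bigD1 a) //= orth eqxx conjC1 mulr1 big1 ?addr0 // => b /andP[_ ba].
  by rewrite orth eq_sym (negPf ba) mul0r.
rewrite (_ : q%:R - 1 = (q - 1)%:R); last by rewrite natrB.
by rewrite rmorph_nat sumr_const card_ord_neq0.
Qed.

End Fourier.

(** * The noisy inner product *)

Section Noise.
Variables (R : realType) (k q : nat).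
Hypotheses (hk : (2 <= k)%N) (hq : (1 <= q)%N).
Variables (Omega : 'I_k -> finType) (mu : {dffun forall i : 'I_k, Omega i} -> R).
Hypotheses (hmu : is_distr mu) (hindep : pairwise_independent mu).
Variable chi : forall i : 'I_k, 'I_q -> Omega i -> R[i].
Arguments chi : clear implicits.
Hypothesis chiP : forall i, is_fourier_basis (@marginal R k Omega mu i) (chi i).

Local Notation marg i := (@marginal R k Omega mu i).
Let z : 'I_q := Ordinal hq.

Lemma neq_z (a : 'I_q) : (a != z) = (a != 0%N :> nat).
Proof. by rewrite -val_eqE. Qed.

Lemma sum_marginal (i : 'I_k) (h : Omega i -> R) :
  \sum_x mu x * h (x i) = \sum_a marg i a * h a.
Proof.
rewrite (partition_big (fun x : {dffun forall i : 'I_k, Omega i} => x i) predT) //=.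
apply: eq_bigr => a _.
by rewrite mulr_suml; apply: eq_bigr => x /eqP ->.
Qed.

Lemma expect_pair (i j : 'I_k) (phi : Omega i -> R[i]) (psi : Omega j -> R[i]) :
  i != j -> expect mu (fun x => phi (x i) * psi (x j)) =
    expect (marg i) phi * expect (marg j) psi.
Proof.
move=> ij; rewrite /expect mulr_suml.
rewrite (partition_big (fun x : {dffun forall i : 'I_k, Omega i} => x i) predT) //=.
apply: eq_bigr => a _.
rewrite mulr_sumr.
rewrite (partition_big (fun x : {dffun forall i : 'I_k, Omega i} => x j) predT) //=.
apply: eq_bigr => b _.
have -> : (marg i a)%:C * phi a * ((marg j b)%:C * psi b) =
   (marg i a * marg j b)%:C * (phi a * psi b) by rewrite creal_mul; ring.
have <- : prob mu (fun x => (x i == a) && (x j == b)) = marg i a * marg j b.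
  (* [hindep] speaks of increasing indices only; the other order follows by symmetry. *)
  have [ltij|ltji|/val_inj eqij] := ltngtP i j.
  - exact: hindep.
  - by rewrite mulrC -hindep //; apply: eq_bigl => x; rewrite andbC.
  - by rewrite eqij eqxx in ij.
rewrite /prob creal_sum mulr_suml; apply: eq_bigr => x /andP[/eqP -> /eqP ->].
by [].
Qed.

Definition column_coef (a : {ffun 'I_k -> 'I_q}) : R[i] :=
  expect mu (fun x => \prod_i chi i (a i) (x i)).

Lemma chi_z i x : chi i z x = 1.
Proof. by case: (chiP i) => chi0 _ _; apply: chi0. Qed.

Lemma column_coef0 a : fsupp z a = finset.set0 -> column_coef a = 1.
Proof.
move=> a0; have [_ mu1] := hmu; rewrite /column_coef /expect.
rewrite (eq_bigr (fun x => (mu x)%:C)); first by rewrite -creal_sum mu1.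
move=> x _; rewrite big1 ?mulr1 // => i _.
have /finset.setP/(_ i) := a0; rewrite !inE => /negbFE/eqP ->; exact: chi_z.
Qed.

(** Such a support lies in a pair of rows, on which pairwise independence splits the expectation;
    one factor is the mean of a basis function of nonzero index, hence 0. *)
Lemma column_coef12 a : (0 < #|fsupp z a| < 3)%N -> column_coef a = 0.
Proof.
case/andP => /card_gt0P[i ia] a3.
have [j ji aij] : exists2 j, j != i & fsupp z a \subset [set i; j].
  (* If the support is a single row, any other row completes the pair; there is one since
     [2 <= k]. *)
  have [a1|[j]] := finset.set_0Vmem (fsupp z a :\ i).
    have /card_gt0P[j] : (0 < #|predC1 i|)%N.
      by have := cardC1 i; rewrite card_ord; move: hk; lia.
    rewrite inE => ji; exists j => //.
    by rewrite -(finset.setD1K ia) a1 finset.setU0 finset.sub1set !inE eqxx.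
  rewrite finset.in_setD1 => /andP[ji ja]; exists j => //.
  rewrite -(finset.setD1K ia) finset.setUS //.
  rewrite -(@finset.setD1K _ j (fsupp z a :\ i)); last first.
    by rewrite finset.in_setD1 ji.
  suff -> : fsupp z a :\ i :\ j = finset.set0 by rewrite finset.setU0.
  apply/eqP; rewrite -cards_eq0; move: a3.
  by rewrite (cardsD1 i) ia (cardsD1 j (_ :\ i)) finset.in_setD1 ji ja /=; lia.
rewrite /column_coef.
transitivity (expect mu (fun x => chi i (a i) (x i) * chi j (a j) (x j))).
  apply: eq_bigr => x _; congr (_ * _).
  rewrite (bigD1 i) //= (bigD1 j) //= big1 ?mulr1 // => i' /andP[i'i i'j].
  have /fintype.subsetP/(_ i') := aij; rewrite !inE (negPf i'i) (negPf i'j) /=.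
  by case: eqVneq => [-> _|_ /(_ isT)] //; exact: chi_z.
rewrite expect_pair 1?eq_sym // (expect_basis (chiP i)) ?mul0r //.
by move: ia; rewrite inE neq_z.
Qed.

(** [B ^+ 2] bounds both the rank [q - 1] and the kernel pointwise. It will be (q - 1) / alpha for
    general bases and q - 1 for characters. *)
Variable B : R.
Hypotheses (B1 : 1 <= B) (qB : q%:R - 1 <= B ^+ 2).
Hypothesis chiB : forall i x,
  \sum_(a : 'I_q | a != 0%N :> nat) normc (chi i a x) ^+ 2 <= B ^+ 2.

Let K i (x y : Omega i) : R[i] :=
  \sum_(a : 'I_q | a != 0%N :> nat) chi i a x * (chi i a y)^*.

Lemma normc_kernel_le i (x y : Omega i) : normc (K x y) <= B ^+ 2.
Proof.
apply: le_trans (normc_sum _ _) _.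
apply: (@le_trans _ _ (\sum_(a : 'I_q | a != 0%N :> nat)
    (normc (chi i a x) ^+ 2 + normc (chi i a y) ^+ 2) / 2)).
  apply: ler_sum => a _; rewrite Normc.normcM normc_conj.
  by have := sqr_ge0 (normc (chi i a x) - normc (chi i a y)); lra.
rewrite -mulr_suml big_split /=.
by have := chiB x; have := chiB y; lra.
Qed.

Lemma sum_sqr_kernel_row (i : 'I_k) :
  \sum_x \sum_y mu x * mu y * normc (K (x i) (y i)) ^+ 2 = q%:R - 1.
Proof.
rewrite -(sum_sqr_kernel (chiP i) hq).
under eq_bigr do under eq_bigr do rewrite -mulrA.
under eq_bigr do rewrite -mulr_sumr
  (sum_marginal (fun b => normc (K _ b) ^+ 2)).
rewrite (sum_marginal (fun a => \sum_b marg i b * normc (K a b) ^+ 2)).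
apply: eq_bigr => a _; rewrite mulr_sumr; apply: eq_bigr => b _.
by rewrite mulrA.
Qed.

(* Expanding the squares, the sum is the expectation over two independent
   samples x, y of the product over P of the kernels K (x_i, y_i); two of them
   are estimated in mean square, the others pointwise. *)
Lemma sum_sqr_column_coef (P : {set 'I_k}) : (3 <= #|P|)%N ->
  \sum_(a | fsupp z a == P) normc (column_coef a) ^+ 2 <= B ^+ (#|P|.-1).*2.
Proof.
move=> P3; have [mu0 mu1] := hmu.
have B0 : 0 <= B by apply: le_trans B1.
pose KP i (x y : Omega i) : R[i] :=
  \sum_(b | (b != z) == (i \in P)) chi i b x * (chi i b y)^*.
have E : (\sum_(a | fsupp z a == P) normc (column_coef a) ^+ 2)%:C =
    \sum_x \sum_y (mu x)%:C * (mu y)%:C * \prod_i KP i (x i) (y i).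
  rewrite creal_sum; transitivity (\sum_(a | fsupp z a == P) \sum_x \sum_y
    (mu x)%:C * (mu y)%:C * \prod_i (chi i (a i) (x i) * (chi i (a i) (y i))^*)).
    apply: eq_bigr => a _; rewrite sqr_normcE conj_sum mulr_suml.
    apply: eq_bigr => x _; rewrite mulr_sumr; apply: eq_bigr => y _.
    by rewrite big_split conj_mul conj_creal conj_prod /=; ring.
  rewrite exchange_big /=; apply: eq_bigr => x _.
  rewrite exchange_big /=; apply: eq_bigr => y _.
  rewrite -mulr_sumr; congr (_ * _).
  exact: (sum_fsupp_prod z P (fun i b => chi i b (x i) * (chi i b (y i))^*)).
have /card_gt0P[i1 i1P] : (0 < #|P|)%N by apply: leq_trans P3.
have /card_gt0P[i2] : (0 < #|P :\ i1|)%N.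
  by move: P3; rewrite (cardsD1 i1) i1P; lia.
rewrite finset.in_setD1 => /andP[i21 i2P].
have KPi i x y : i \in P -> KP i x y = K x y.
  move=> iP; apply: eq_bigl => b; rewrite iP eqb_id; exact: neq_z.
(* Rows [i1] and [i2] are separated by u v <= (u^2 + v^2) / 2, so that each square can be averaged
   to [q - 1]; every other row of [P] costs [B ^+ 2]. *)
have KP_le (x y : {dffun forall i : 'I_k, Omega i}) :
    normc (\prod_i KP i (x i) (y i)) <= B ^+ (#|P| - 2).*2 *
    ((normc (K (x i1) (y i1)) ^+ 2 + normc (K (x i2) (y i2)) ^+ 2) / 2).
  rewrite normc_prod (bigD1 i1) //= (bigD1 i2) //= mulrA mulrC.
  rewrite !KPi //; apply: ler_pM.
  - by apply: prodr_ge0 => i _; exact: normc_ge0.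
  - by rewrite mulr_ge0 ?normc_ge0.
  - apply: (@le_trans _ _ (\prod_(i | (i != i1) && (i != i2))
      (if i \in P then B ^+ 2 else 1))).
      apply: ler_prod => i _; rewrite normc_ge0 /=; case: ifP => iP.
        by rewrite KPi // normc_kernel_le.
      rewrite /KP iP (eq_bigl (pred1 z)) => [|b]; last first.
        by rewrite eqbF_neg negbK.
      by rewrite big_pred1_eq !chi_z conjC1 mulr1 Normc.normc1.
    rewrite -big_mkcondr /= prodr_const -exprM mul2n.
    rewrite (@eq_card _ _ (P :\ i1 :\ i2)) => [|i]; last first.
      rewrite [RHS]finset.in_setD1 finset.in_setD1 andbA.
      by rewrite [(i != i2) && _]andbC; exact: erefl.
    rewrite (cardsD1 i1 P) i1P (cardsD1 i2 (P :\ i1)) finset.in_setD1 i21 i2P /=.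
    by rewrite addnA addKn.
  by have := sqr_ge0 (normc (K (x i1) (y i1)) - normc (K (x i2) (y i2))); lra.
rewrite -[leLHS]normc_real; last by apply: sumr_ge0 => a _; exact: sqr_ge0.
rewrite E; apply: le_trans (normc_sum _ _) _.
apply: (@le_trans _ _ (\sum_x \sum_y B ^+ (#|P| - 2).*2 / 2 *
   (mu x * mu y * normc (K (x i1) (y i1)) ^+ 2 +
    mu x * mu y * normc (K (x i2) (y i2)) ^+ 2))).
  apply: ler_sum => x _; apply: le_trans (normc_sum _ _) _.
  apply: ler_sum => y _; rewrite 2!Normc.normcM !normc_real //.
  have := KP_le x y => /(ler_wpM2l (mulr_ge0 (mu0 x) (mu0 y))).
  by move/le_trans; apply; rewrite le_eqVlt; apply/orP; left; apply/eqP; ring.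
under eq_bigr do rewrite -mulr_sumr big_split /=.
rewrite -mulr_sumr big_split /= !sum_sqr_kernel_row.
have -> : (#|P|.-1).*2 = ((#|P| - 2).*2 + 2)%N by move: P3; lia.
rewrite exprD; have : 0 <= B ^+ (#|P| - 2).*2 by rewrite exprn_ge0.
by move: (B ^+ _.*2) qB => t; move: (B ^+ 2) => u; nra.
Qed.

Variable n : nat.
Variable f : forall i : 'I_k, {ffun 'I_n -> Omega i} -> R[i].
Arguments f : clear implicits.

Let fhat i := fcoef (marg i) (chi i) (f i).

Let term (s : {ffun 'I_n -> {ffun 'I_k -> 'I_q}}) : R[i] :=
  (\prod_j column_coef (s j)) * \prod_i fhat i (frow s i).

(** The product of the expansions of the [f i] is a sum over arrays; for a fixed array, the
    expectation over [X] factors over the independent columns. *)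
Lemma noisy_inner_expansion : noisy_inner mu f = \sum_s term s.
Proof.
rewrite /noisy_inner {1}/expect.
transitivity (\sum_(X : {ffun 'I_n -> {dffun forall i : 'I_k, Omega i}})
   \sum_(s : {ffun 'I_n -> {ffun 'I_k -> 'I_q}})
   (\prod_i fhat i (frow s i)) *
    \prod_j ((mu (X j))%:C * \prod_i chi i (s j i) (X j i))).
  apply: eq_bigr => X _.
  under eq_bigr do rewrite (fourier_expansion (chiP _)).
  rewrite bigA_distr_bigA /= sum_frow mulr_sumr; apply: eq_bigr => s _.
  rewrite /iid creal_prod !big_split /= mulrCA; congr (_ * _).
    by apply: eq_bigr => i _; rewrite ffunE.
  congr (_ * _); rewrite exchange_big /=; apply: eq_bigr => i _.
  by apply: eq_bigr => j _; rewrite !ffunE.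
rewrite exchange_big /=; apply: eq_bigr => s _.
rewrite -mulr_sumr mulrC; congr (_ * _).
by rewrite -(bigA_distr_bigA (fun j x =>
  (mu x)%:C * \prod_i chi i (s j i) (x i))).
Qed.

Let s0 : {ffun 'I_n -> {ffun 'I_k -> 'I_q}} := [ffun=> [ffun=> z]].

Lemma term0 : term s0 = \prod_i mean mu f i.
Proof.
rewrite /term big1 ?mul1r => [|j _]; last first.
  by apply: column_coef0; apply/finset.setP => i; rewrite !inE !ffunE eqxx.
apply: eq_bigr => i _; apply: fcoef_weight0 => //.
by apply/eqP; rewrite cards_eq0; apply/eqP/finset.setP => j; rewrite !inE !ffunE.
Qed.

(** In a nonzero term, a nonzero column has at least three nonzero entries, and only two rows have
    index at least [k - 2]. This is why [delta] may leave out the last two functions. *)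
Lemma term_low_row s : s != s0 -> term s != 0 ->
  exists2 i : 'I_k, (i < k - 2)%N & (0 < weight (frow s i))%N.
Proof.
move=> ss0; rewrite mulf_eq0 negb_or => /andP[/prodf_neq0 c0 _].
have [j sj] : exists j, (0 < #|fsupp z (s j)|)%N.
  apply/existsP; apply: contraNT ss0 => /existsPn ss0; apply/eqP/ffunP => j.
  apply/ffunP => i; rewrite !ffunE; apply/eqP; move: (ss0 j).
  rewrite -eqn0Ngt cards_eq0 => /eqP/finset.setP/(_ i).
  by rewrite !inE => /negbFE.
have sj3 : (3 <= #|fsupp z (s j)|)%N.
  by rewrite leqNgt; apply: contra (c0 j isT) => sj2; rewrite column_coef12 ?sj.
have [i ij ik] : exists2 i : 'I_k, i \in fsupp z (s j) & (i < k - 2)%N.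
  apply/exists_inP; apply: contraLR sj3 => /exists_inPn sjk.
  rewrite -ltnNge ltnS.
  have k2 : (k - 2 < k)%N by move: hk; lia.
  have k1 : (k - 1 < k)%N by move: hk; lia.
  apply: leq_trans (_ : (#|[set Ordinal k2; Ordinal k1]| <= 2)%N); last first.
    by rewrite cards2; case: (_ != _).
  apply: subset_leq_card; apply/fintype.subsetP => i /sjk; rewrite !inE -!val_eqE /=.
  by have := ltn_ord i; move: hk; lia.
exists i => //; apply/card_gt0P; exists j.
by move: ij; rewrite !inE ffunE neq_z.
Qed.

(** Double counting of the nonzero entries in the rows of [L]. It turns the powers of [C] attached
    to columns into row weights, which the degrees control. *)
Lemma sum_card_fsupp (L : {set 'I_k}) (s : {ffun 'I_n -> {ffun 'I_k -> 'I_q}}) :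
  (\sum_j #|fsupp z (s j) :&: L| = \sum_(i in L) weight (frow s i))%N.
Proof.
transitivity (\sum_j \sum_(i in L) (s j i != z))%N.
  apply: eq_bigr => j _; rewrite -sum1_card big_mkcond [RHS]big_mkcond /=.
  by apply: eq_bigr => i _; rewrite !inE; case: (i \in L); rewrite ?andbF ?andbT;
    case: (s j i != z).
rewrite exchange_big /=; apply: eq_bigr => i _.
rewrite /weight -sum1_card [RHS]big_mkcond /=; apply: eq_bigr => j _.
by rewrite !inE ffunE -neq_z; case: (s j i != z).
Qed.

Let C := (k%:R * B) ^+ 3.

Lemma C_ge1 : 1 <= C.
Proof.
have k1 : 1 <= k%:R :> R by rewrite ler1n; apply: leq_trans hk.
apply: exprn_ege1; apply: le_trans (_ : k%:R <= _) => //.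
by rewrite ler_peMr // (le_trans ler01).
Qed.

Variables (L : {set 'I_k}) (d : 'I_k -> nat).
Hypothesis cardL : #|L| = (k - 2)%N.
Hypothesis fhat_deg : forall i sigma, (d i < weight sigma)%N -> fhat i sigma = 0.
Hypothesis f_norm : forall i, norm2 (iid (marg i) (n := n)) (f i) <= 1.

Lemma sum_term_row_le (i0 : 'I_k) :
  \sum_(s | (0 < weight (frow s i0))%N) normc (term s)
    <= max_fcoef (marg i0) (chi i0) (f i0) * C ^+ \sum_(i in L) d i.
Proof.
set M := max_fcoef _ _ _; set D := (\sum_(i in L) d i)%N.
have M0 : 0 <= M by apply: bigmax_ge_id.
have C1 := C_ge1; have C0 : 0 < C := lt_le_trans ltr01 C1.
pose kap a := normc (column_coef a) * C ^- #|fsupp z a :&: L|.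
have kap0 a : 0 <= kap a.
  by rewrite mulr_ge0 ?normc_ge0 // invr_ge0 exprn_ge0 // ltW.
pose W (s : {ffun 'I_n -> {ffun 'I_k -> 'I_q}}) :=
  (\prod_j kap (s j)) * \prod_(i | i != i0) normc (fhat i (frow s i)).
have W0 s : 0 <= W s.
  rewrite mulr_ge0 // prodr_ge0 // => i _; exact: normc_ge0.
apply: (@le_trans _ _ (\sum_s M * C ^+ D * W s)).
  rewrite [leLHS]big_mkcond /=; apply: ler_sum => s _; case: ifP => si0; last first.
    by rewrite mulr_ge0 // mulr_ge0 // exprn_ge0 // ltW.
  have [->|] := eqVneq (term s) 0.
    by rewrite Normc.normc0 mulr_ge0 // mulr_ge0 // exprn_ge0 // ltW.
  rewrite mulf_eq0 negb_or => /andP[_ /prodf_neq0 fs0].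
  (* All coefficients in a nonzero term are nonzero, so the weight of each row is at most its
     degree. *)
  have ds : (\sum_j #|fsupp z (s j) :&: L| <= D)%N.
    rewrite sum_card_fsupp; apply: leq_sum => i _.
    by rewrite leqNgt; apply/negP => /fhat_deg /eqP; apply/negP/fs0.
  rewrite Normc.normcM !normc_prod /W /kap big_split /=.
  rewrite [in leLHS](bigD1 i0) //=.
  have -> : \prod_(j < n) C ^- #|fsupp z (s j) :&: L|
      = C ^- (\sum_j #|fsupp z (s j) :&: L|)%N.
    rewrite prodfV; congr (_^-1); symmetry.
    exact: (big_morph (fun m => C ^+ m) (fun _ _ => exprD _ _ _) (expr0 _)).
  set S := (\sum_j _)%N in ds *.
  have -> : forall p e c g : R, M * e * (p * c * g) = (p * g) * (M * (e * c)).
    by move=> *; ring.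
  rewrite [leLHS]mulrCA [leLHS]mulrC ler_wpM2l //.
    by rewrite mulr_ge0 // prodr_ge0 // => *; exact: normc_ge0.
  (* Row [i0] is nonzero, so its coefficient is at most [M]; and [C ^+ D / C ^+ S] is at least 1
     because [S <= D]. *)
  apply: (@le_trans _ _ M).
    by apply: (le_bigmax_cond _ (fun t => normc (fhat i0 t))).
  rewrite ler_peMr // ler_pdivlMr; last exact: exprn_gt0.
  by rewrite mul1r ler_weXn2l.
have MC0 : 0 <= M * C ^+ D by rewrite mulr_ge0 // exprn_ge0 // ltW.
rewrite -mulr_sumr ler_piMr //.
(* The tensorized inequality for the rows other than [i0]; by Parseval its right-hand side is a
   product of norms of the [f i], each at most 1. *)
apply: le_trans (@tensor_bound _ _ _ (fun i => i != i0) kap kap0 _ n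
  (fun i t => normc (fhat i t)) _) _; last 2 first.
- by move=> i t; exact: normc_ge0.
- apply: prodr_ile1 => i _; rewrite sqrtr_ge0 /=.
  by rewrite (parseval (chiP i)); exact: f_norm.
move=> G G0; rewrite /kap /C; have := @column_bound R 'I_k 'I_q z i0 L B
  (fun a => normc (column_coef a)); rewrite !card_ord; apply=> //.
- by move=> a; exact: normc_ge0.
- by move=> a a0; rewrite column_coef0 // Normc.normc1.
- by move=> a a12; rewrite column_coef12 // Normc.normc0.
- exact: sum_sqr_column_coef.
Qed.

(** The zero array accounts for the product of the means. Every other nonzero term is counted at
    least once in the sums over arrays with a given nonzero row [i < k - 2], whence the factor
    [k - 2]. *)
Lemma noisy_inner_bound :
  normc (noisy_inner mu f - \prod_i mean mu f i)
    <= delta mu chi f * (k - 2)%:R * C ^+ \sum_(i in L) d i.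
Proof.
rewrite noisy_inner_expansion -term0 (bigD1 s0) //= addrC addrK.
apply: le_trans (normc_sum _ _) _.
apply: (@le_trans _ _ (\sum_(i < k | (i < k - 2)%N)
    \sum_(s | (0 < weight (frow s i))%N) normc (term s))).
  rewrite (exchange_big_dep predT) //= big_mkcond /=; apply: ler_sum => s _.
  have S0 (P : pred 'I_k) : 0 <= \sum_(i | P i) normc (term s).
    by apply: sumr_ge0 => i _; exact: normc_ge0.
  case: ifP => // ss0; have [->|ts] := eqVneq (term s) 0.
    by rewrite Normc.normc0 sumr_ge0.
  have [i ik si] := term_low_row ss0 ts.
  by rewrite (bigD1 i) ?ik //= lerDl.
apply: (@le_trans _ _ (\sum_(i < k | (i < k - 2)%N)
   delta mu chi f * C ^+ \sum_(i in L) d i)).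
  apply: ler_sum => i ik; apply: le_trans (sum_term_row_le i) _.
  apply: ler_wpM2r; first exact/exprn_ge0/(le_trans ler01 C_ge1).
  exact: (le_bigmax_cond _
    (fun i => max_fcoef (marg i) (chi i) (f i))).
by rewrite (big_ord_narrow (leq_subr 2 k)) sumr_const card_ord -[leLHS]mulr_natr mulrAC.
Qed.

End Noise.

(** * Degrees as natural numbers *)

Section Degree.
Variables (R : realType) (T : finType) (w : T -> R) (q n : nat).
Variables (chi : 'I_q -> T -> R[i]) (f : {ffun 'I_n -> T} -> R[i]).

(** If all coefficients vanish, this maximum is 0 while [fdeg] is minus infinity. *)
Definition max_weight : nat :=
  \max_(sigma : {ffun 'I_n -> 'I_q} | fcoef w chi f sigma != 0) weight sigma.

Lemma fcoef_max_weight sigma :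
  (max_weight < weight sigma)%N -> fcoef w chi f sigma = 0.
Proof.
rewrite ltnNge; apply: contraNeq => f0.
exact: leq_bigmax_cond.
Qed.

(** The maximum is attained at a nonzero coefficient, which excludes all smaller integers from the
    set whose infimum is taken. *)
Lemma fdeg_max_weight sigma0 : fcoef w chi f sigma0 != 0 ->
  fdeg w chi f = (max_weight%:R)%:E.
Proof.
move=> f0; apply/eqP; rewrite eq_le; apply/andP; split.
  apply: ereal_inf_lbound; exists max_weight%:Z => // sigma.
  exact: fcoef_max_weight.
apply: le_ereal_inf_tmp => _ [m mP <-].
have [|sigma f1 mw] := @eq_bigmax_cond _
    [pred s : {ffun 'I_n -> 'I_q} | fcoef w chi f s != 0] (fun s => weight s).
  by apply/card_gt0P; exists sigma0.
have {mw} -> : max_weight = weight sigma by exact: mw.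
rewrite lee_fin pmulrn ler_int leNgt; apply/negP => /mP /eqP.
by apply/negP.
Qed.

End Degree.

(** * The bound for arbitrary Fourier bases *)

Section LowCorrelation.
Variables (R : realType) (k q : nat).
Hypotheses (hk : (2 <= k)%N) (hq : (1 <= q)%N).
Variables (Omega : 'I_k -> finType) (mu : {dffun forall i : 'I_k, Omega i} -> R).
Hypotheses (hmu : is_distr mu) (hindep : pairwise_independent mu).
Variable chi : forall i : 'I_k, 'I_q -> Omega i -> R[i].
Hypothesis chiP : forall i, is_fourier_basis (@marginal R k Omega mu i) (@chi i).
Variable B : R.
Hypotheses (B1 : 1 <= B) (qB : q%:R - 1 <= B ^+ 2).
Hypothesis chiB : forall i x,
  \sum_(a : 'I_q | a != 0%N :> nat) normc (@chi i a x) ^+ 2 <= B ^+ 2.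

Lemma delta_ge0 n (f : forall i : 'I_k, {ffun 'I_n -> Omega i} -> R[i]) :
  0 <= delta mu chi f.
Proof. exact: bigmax_ge_id. Qed.

Lemma pow_ereal_ge0 (c : R) D : 0 <= c -> 0 <= pow_ereal c D.
Proof. by move=> c0; case: D => //= d; exact: powR_ge0. Qed.

Lemma low_correlation_basis n :
  low_correlation mu chi ((k%:R * B) ^+ 3) n.
Proof.
move=> f fn; set C := (_ ^+ 3).
have C0 : 0 <= C by rewrite exprn_ge0 // mulr_ge0 // (le_trans ler01).
pose w i := @marginal R k Omega mu i.
(* If some [f i] is zero, the left-hand side is 0 and the right-hand side is nonnegative. Otherwise
   all degrees are natural numbers. *)
have [/existsP[i /forallP fi0]|/existsPn fn0] :=
    boolP [exists i, forall s, fcoef (w i) (@chi i) (@f i) s == 0].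
  have f0 x : f i x = 0.
    by apply: (fcoef_eq0 (chiP i)) => s; apply/eqP.
  have -> : noisy_inner mu f = 0.
    by apply: big1 => X _; rewrite (bigD1 i) //= f0 mul0r mulr0.
  have -> : \prod_j mean mu f j = 0.
    by rewrite (bigD1 i) //= [mean _ _ _]big1 ?mul0r // => x _; rewrite f0 mulr0.
  by rewrite subrr Normc.normc0 mulr_ge0 ?pow_ereal_ge0 // mulr_ge0 ?delta_ge0.
pose d i := max_weight (w i) (@chi i) (@f i).
have dE i : fdeg (w i) (@chi i) (@f i) = ((d i)%:R)%:E.
  have /forallPn[s fs] := fn0 i; exact: fdeg_max_weight fs.
(* Indices are sorted rather than degrees, so that the first [k - 2] of them form the set [L] of
   [noisy_inner_bound]. *)
pose l := take (k - 2) (sort (relpre (fun i => ((d i)%:R)%:E : \bar R) <=%O)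
   (enum 'I_k)).
have ul : uniq l by rewrite take_uniq // sort_uniq enum_uniq.
have sl : size l = (k - 2)%N.
  by rewrite size_takel // size_sort size_enum_ord leq_subr.
have -> : deg_m2 mu chi f = ((\sum_(i in finset (mem l)) d i)%N%:R)%:E.
  rewrite /deg_m2 (eq_map dE) sort_map -map_take big_map sumEFin.
  rewrite natr_sum -/l; congr EFin.
  by rewrite (big_uniq _ ul); apply: eq_bigl => i; rewrite inE.
rewrite /= powR_mulrn //; apply: (noisy_inner_bound hk hq) => //.
  by rewrite cardsE -sl; apply/card_uniqP.
by move=> i s; exact: fcoef_max_weight.
Qed.

End LowCorrelation.

(** The only index is 0, so no [sigma] has positive weight and the maxima are over the empty set. *)
Lemma delta_le0 (R : realType) k (Omega : 'I_k -> finType) mu n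
    (chi : forall i : 'I_k, 'I_1 -> Omega i -> R[i])
    (f : forall i : 'I_k, {ffun 'I_n -> Omega i} -> R[i]) :
  delta mu chi f <= 0.
Proof.
apply/bigmax_leP; split=> // i _; apply/bigmax_leP; split=> // s.
by rewrite card_gt0 => /set0Pn[j]; rewrite inE ord1.
Qed.

(** * Characters of a cyclic group *)

Lemma exists_prim_root (F : numClosedFieldType) n : (0 < n)%N ->
  exists x : F, n.-primitive_root x.
Proof.
move=> n0; pose p : {poly F} := 'X^n - 1.
have [r Dp] := closed_field_poly_normal p.
rewrite (monicP _) ?monicXnsubC // scale1r in Dp.
have rn1 : all n.-unity_root r by apply/allP => x; rewrite -root_prod_XsubC -Dp.
have sz_r : (n < (size r).+1)%N.
  by rewrite -(size_prod_XsubC r id) -Dp size_XnsubC.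
(* Among [n] distinct [n]-th roots of unity one is primitive; they are distinct because ['X^n - 1]
   is separable in characteristic 0. *)
have [|x] := hasP (has_prim_root n0 rn1 _ sz_r); last by exists x.
rewrite -separable.separable_prod_XsubC -Dp cyclotomic.separable_Xn_sub_1 //.
by rewrite pnatr_eq0 -lt0n.
Qed.

Lemma sum_unity_root (F : fieldType) n (x : F) : x ^+ n = 1 ->
  \sum_(i < n) x ^+ i = if x == 1 then n%:R else 0.
Proof.
move=> xn; have [->|x1] := eqVneq x 1.
  by under eq_bigr do rewrite expr1n; rewrite sumr_const card_ord.
apply: (mulfI (_ : x - 1 != 0)); first by rewrite subr_eq0.
by rewrite -subrX1 xn subrr mulr0.
Qed.

Section Characters.
Variables (R : realType) (T : finType) (w : T -> R) (q : nat) (omega : R[i]).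
Hypotheses (hq : (0 < q)%N) (cardT : #|T| = q) (wP : is_uniform w).
Hypothesis prim : q.-primitive_root omega.

(** The characters of the additive group Z_q, transported to [T] by its enumeration. *)
Definition character (a : 'I_q) (x : T) : R[i] := omega ^+ (a * enum_rank x).

Lemma normc_root : normc omega = 1.
Proof.
apply/eqP; rewrite -(@pexpr_eq1 _ _ q) ?normc_ge0 //.
rewrite -(Normc.normc1 R) -(prim_expr_order prim); apply/eqP.
by elim: (q) => [|m IHm]; rewrite ?Normc.normc1 // !exprS Normc.normcM IHm.
Qed.

Lemma normc_character a x : normc (character a x) = 1.
Proof.
rewrite /character; elim: (a * _)%N => [|m IHm]; first exact: Normc.normc1.
by rewrite exprS Normc.normcM IHm normc_root mulr1.
Qed.

Let omegaJ : omega * omega^*%R = 1.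
Proof. by rewrite -sqr_normcE normc_root expr1n. Qed.

(** The exponent is symmetric in index and point, so this relation gives both orthonormality and
    completeness. *)
Let sum_pow (b c : 'I_q) :
  \sum_(m < q) omega ^+ (b * m) * (omega ^+ (c * m))^*%R = q%:R *+ (b == c).
Proof.
have E m : omega ^+ (b * m) * (omega ^+ (c * m))^*%R
    = (omega ^+ b * (omega ^+ c)^*%R) ^+ m.
  by rewrite exprMn -!exprM -rmorphXn -exprM.
under eq_bigr do rewrite E.
have cJ m : omega ^+ m * (omega ^+ m)^*%R = 1.
  by rewrite rmorphXn -exprMn omegaJ expr1n.
rewrite sum_unity_root; last first.
  rewrite exprMn -rmorphXn /= -!exprM ![(_ * q)%N]mulnC !exprM.
  by rewrite (prim_expr_order prim) !expr1n conjC1 mulr1.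
suff -> : (omega ^+ b * (omega ^+ c)^*%R == 1) = (b == c) by case: (b == c).
apply/eqP/eqP => [bc|->]; last exact: cJ.
have /eqP : omega ^+ b = omega ^+ c.
  by rewrite -[RHS]mul1r -bc -mulrA [_^*%R * _]mulrC cJ mulr1.
by rewrite (eq_prim_root_expr prim) !modn_small // => /eqP/val_inj.
Qed.

Lemma character_basis : is_fourier_basis w character.
Proof.
have q0 : (q%:R : R[i]) != 0 by rewrite pnatr_eq0 -lt0n.
have wE x : (w x)%:C = q%:R^-1 by rewrite wP cardT fmorphV rmorph_nat.
have rank_bij : {on predT, bijective (fun x : T => cast_ord cardT (enum_rank x))}.
  exists (fun m => enum_val (cast_ord (esym cardT) m)) => x _.
    by rewrite cast_ordK enum_rankK.
  by rewrite enum_valK cast_ordKV.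
split=> [a a0 x|a b|f]; first by rewrite /character a0.
- transitivity (q%:R^-1 * \sum_(m < q) omega ^+ (a * m) * (omega ^+ (b * m))^*%R).
    rewrite (reindex _ rank_bij) mulr_sumr; apply: eq_bigr => x _.
    by rewrite wE.
  by rewrite sum_pow -[q%:R *+ _]mulr_natr mulrA mulVf // mul1r.
- exists (fun a => inner w f (character a)) => x.
  transitivity (\sum_y f y * (x == y)%:R).
    rewrite (bigD1 x) //= eqxx mulr1 big1 ?addr0 // => y.
    by rewrite eq_sym => /negPf ->; rewrite mulr0.
  rewrite /inner /expect; under [RHS]eq_bigr do rewrite mulr_suml.
  rewrite exchange_big; apply: eq_bigr => y _.
  have := sum_pow (cast_ord cardT (enum_rank x)) (cast_ord cardT (enum_rank y)).
  rewrite (inj_eq (@cast_ord_inj _ _ _)) (inj_eq enum_rank_inj) => xy.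
  transitivity (f y * (q%:R^-1 * (q%:R *+ (x == y)))).
    by rewrite -[q%:R *+ _]mulr_natr mulrA mulVf // mul1r.
  rewrite -xy !mulr_sumr; apply: eq_bigr => a _; rewrite wE /character.
  by rewrite ![(a * _)%N]mulnC; ring.
Qed.

End Characters.

(** * The least atom of the marginals *)

Section Alpha.
Variables (R : realType) (k : nat) (Omega : 'I_k -> finType).
Variable mu : {dffun forall i : 'I_k, Omega i} -> R.
Hypothesis hpos : forall (i : 'I_k) (x : Omega i), 0 < marginal mu x.

Lemma alpha_le1 : alpha mu <= 1.
Proof. exact: bigmin_le_id. Qed.

Lemma alpha_gt0 : 0 < alpha mu.
Proof.
apply/bigmin_gtP; split=> // i _; apply/bigmin_gtP; split=> // x _.
Qed.

Lemma alpha_le_marginal (i : 'I_k) (x : Omega i) : alpha mu <= marginal mu x.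
Proof.
apply: le_trans (_ : min_atom (@marginal R k Omega mu i) <= _).
  exact: (bigmin_le_cond _ (fun i => min_atom (@marginal R k Omega mu i))).
by apply: (bigmin_le_cond _ (fun x => marginal mu x)); rewrite gt_eqF.
Qed.

End Alpha.

Theorem corollary3p6 (R : realType) (k q : nat) (hk : (2 <= k)%N)
    (hq : (1 <= q)%N) (Omega : 'I_k -> finType)
    (hOmega : forall i, #|Omega i| = q)
    (mu : {dffun forall i : 'I_k, Omega i} -> R)
    (hmu : is_distr mu)
    (hindep : pairwise_independent mu)
    (hpos : forall (i : 'I_k) (x : Omega i), 0 < marginal mu x) :
  [/\ exists C : R, 0 <= C /\
        forall (n : nat) (chi : forall i : 'I_k, 'I_q -> Omega i -> R[i]),
          (forall i, is_fourier_basis (@marginal R k Omega mu i) (chi i)) ->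
          low_correlation mu chi C n,
      forall (n : nat) (chi : forall i : 'I_k, 'I_q -> Omega i -> R[i]),
        (forall i, is_fourier_basis (@marginal R k Omega mu i) (chi i)) ->
        low_correlation mu chi
          ((k%:R * Num.sqrt ((q%:R - 1) / alpha mu)) ^+ 3) n
    & (forall i, is_uniform (@marginal R k Omega mu i)) ->
      exists chi : forall i : 'I_k, 'I_q -> Omega i -> R[i],
        (forall i, is_fourier_basis (@marginal R k Omega mu i) (chi i)) /\
        forall n : nat,
          low_correlation mu chi ((k%:R * Num.sqrt (q%:R - 1)) ^+ 3) n].
Proof.
have a0 := alpha_gt0 hpos; have a1 := alpha_le1 mu.
(* For [q = 1] the constants are 0, but then [delta] vanishes. *)
have small n (chi : forall i : 'I_k, 'I_q -> Omega i -> R[i]) (C : R) :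
    (forall i, is_fourier_basis (@marginal R k Omega mu i) (chi i)) ->
    q = 1%N -> 0 <= C -> low_correlation mu chi C n.
  move=> chiP q1 C0; move: hq chi chiP {hOmega}; rewrite q1 => h1 chi chiP f fn.
  have d0 : delta mu chi f = 0.
    by apply/eqP; rewrite eq_le delta_le0 delta_ge0.
  have := @low_correlation_basis R k 1 hk h1 Omega mu hmu hindep chi chiP 1
    (lexx _) _ _ n f fn.
  rewrite d0 !mul0r; apply.
    by rewrite subrr sqr_ge0.
  by move=> i x; rewrite big1 ?expr1n // => a; rewrite ord1.
(* This makes both choices of [B] at least 1. *)
have q2 : q != 1%N -> 1 <= (q%:R - 1 : R).
  by move=> q1; rewrite lerBrDr -(natrD _ 1 1) ler_nat; move: q1 hq; lia.
have bound n (chi : forall i : 'I_k, 'I_q -> Omega i -> R[i]) :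
    (forall i, is_fourier_basis (@marginal R k Omega mu i) (chi i)) ->
    low_correlation mu chi ((k%:R * Num.sqrt ((q%:R - 1) / alpha mu)) ^+ 3) n.
  move=> chiP; have [q1|/q2 q1] := eqVneq q 1%N.
    by apply: small => //; rewrite exprn_ge0 // mulr_ge0 // sqrtr_ge0.
  have qa : q%:R - 1 <= (q%:R - 1) / alpha mu.
    by rewrite ler_pdivlMr // ler_piMr // (le_trans ler01).
  have qa1 := le_trans q1 qa; have qa0 := le_trans ler01 qa1.
  apply: low_correlation_basis => //.
  - by rewrite -[leLHS]sqrtr1 ler_sqrt.
  - by rewrite sqr_sqrtr.
  (* The sum over all [a] is the inverse of the atom at [x], hence at most 1 / alpha, and [q - 1] is
     at least 1. *)
  move=> i x; rewrite sqr_sqrtr //; apply: le_trans (_ : (alpha mu)^-1 <= _).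
    have := sum_sqr_basis (chiP i) x; set S := \sum_a _ => wS.
    apply: (@le_trans _ _ S).
      rewrite [leRHS](bigID (fun a : 'I_q => a != 0%N :> nat)) /= lerDl.
      by apply: sumr_ge0 => a _; exact: sqr_ge0.
    rewrite -(ler_pM2l (hpos i x)) wS ler_pdivlMr // mul1r.
    exact: alpha_le_marginal.
  by rewrite ler_pMl ?invr_gt0.
split=> //.
  exists ((k%:R * Num.sqrt ((q%:R - 1) / alpha mu)) ^+ 3); split=> //.
move=> uni; have [omega prim] := exists_prim_root R[i] hq.
exists (fun i => character omega); have chiP i :
    is_fourier_basis (@marginal R k Omega mu i) (@character R _ q omega).
  exact: character_basis.
split=> // n; have [q1|/q2 q1] := eqVneq q 1%N.
  by apply: small => //; rewrite exprn_ge0 // mulr_ge0 // sqrtr_ge0.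
have q0 := le_trans ler01 q1.
apply: low_correlation_basis => //.
- by rewrite -[leLHS]sqrtr1 ler_sqrt.
- by rewrite sqr_sqrtr.
(* Characters have modulus 1, so the sum is exactly [q - 1]. *)
move=> i x; rewrite sqr_sqrtr //.
under eq_bigr do rewrite normc_character // expr1n.
by rewrite sumr_const card_ord_neq0 natrB.
Qed.
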